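(* Let $\overrightarrow{G}=(V,E)$ be a strongly connected digraph on $n$ vertices with vertex set $V=\{v_1,\ldots,v_n\}$, let $d_{ij}=d_{\overrightarrow{G}}(v_i,v_j)$ denote the distance from $v_i$ to $v_j$, and let $D_i^+=\sum_{j=1}^n d_{ij}$. Then $$q^{\mathcal{D}}(\overrightarrow{G})\leq \max_{1\leq i\leq n}\Bigg\{D_i^+ +\sqrt{(n-1)\sum_{k=1}^n d_{ki}^2}\Bigg\}$$ and $$\mu^{\mathcal{D}}(\overrightarrow{G})\leq \max_{1\leq i\leq n}\Bigg\{D_i^+ +\sqrt{(n-1)\sum_{k=1}^n d_{ki}^2}\Bigg\}.$$ Moreover, if equality holds in the first inequality (or in the second inequality), then $$D_i^+ +\sqrt{(n-1)\sum_{k=1}^n d_{ki}^2}=D_j^+ +\sqrt{(n-1)\sum_{k=1}^n d_{kj}^2}$$ for any $i,j\in\{1,2,\ldots,n\}$.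
   Context: Digraphs are finite and simple (no loops, no multiple arcs). A digraph is strongly connected if for every pair of vertices $v_i,v_j$ there are directed paths from $v_i$ to $v_j$ and from $v_j$ to $v_i$. The distance $d_{\overrightarrow{G}}(u,v)$ is the length of a shortest directed path from $u$ to $v$. The distance matrix is $\mathcal{D}(\overrightarrow{G})=(d_{ij})$ with $d_{ij}=d_{\overrightarrow{G}}(v_i,v_j)$; $D_i^+=\sum_{j=1}^n d_{ij}$ is the transmission (distance degree) of $v_i$, and $Tr(\overrightarrow{G})=\mathrm{diag}(D_1^+,\ldots,D_n^+)$. The distance Laplacian matrix is $\mathcal{L}(\overrightarrow{G})=Tr(\overrightarrow{G})-\mathcal{D}(\overrightarrow{G})$ and the distance signless Laplacian matrix is $\mathcal{Q}(\overrightarrow{G})=Tr(\overrightarrow{G})+\mathcal{D}(\overrightarrow{G})$. The distance Laplacian spectral radius $\mu^{\mathcal{D}}(\overrightarrow{G})$ and the distance signless Laplacian spectral radius $q^{\mathcal{D}}(\overrightarrow{G})$ are the spectral radii (largest modulus of a complex eigenvalue) of $\mathcal{L}(\overrightarrow{G})$ and $\mathcal{Q}(\overrightarrow{G})$, respectively. *)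

(* Defs.v *)
From mathcomp Require Import all_boot all_order all_algebra.
From mathcomp Require Import complex.

Set Implicit Arguments.
Unset Strict Implicit.
Unset Printing Implicit Defensive.

Import Order.TTheory GRing.Theory Num.Theory.
Local Open Scope ring_scope.

(* The real numbers are an arbitrary real closed field R, with R[i] as the    *)
(* complex numbers. A simple digraph on n vertices is an irreflexive relation *)
(* e on 'I_n, where e u v holds iff there is an arc from u to v.              *)

Section Digraph.
Variables (n : nat) (e : rel 'I_n).

Definition strongly_connected : Prop := forall u v, connect e u v.

Definition has_dipath (u v : 'I_n) (k : nat) : bool :=
  [exists p : k.-tuple 'I_n, [&& path e u p, uniq (u :: p) & last u p == v]].

(* The least k < n such that there is a directed path of length k from u to   *)
(* v. Directed paths on n vertices have length less than n, so the search     *)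
(* fails, with value n, only if v is not reachable from u.                    *)
Definition dist (u v : 'I_n) : nat := find (has_dipath u v) (iota 0 n).

Lemma has_dipath_lt u v k : has_dipath u v k -> (k < n)%N.
Proof.
case/existsP=> p /and3P[_ /card_uniqP + _].
by move=> up; have := max_card [in u :: p]; rewrite up card_ord /= size_tuple.
Qed.

Lemma dist_dipath u v : connect e u v -> has_dipath u v (dist u v).
Proof.
case/connectP=> p ep ->; case/shortenP: ep => q eq uq _.
have hq : has_dipath u (last u q) (size q).
  by apply/existsP; exists (in_tuple q); rewrite /= eq eqxx andbT; exact: uq.
have hf : has (has_dipath u (last u q)) (iota 0 n).
  by apply/hasP; exists (size q); rewrite // mem_iota add0n (has_dipath_lt hq).
have := nth_find 0%N hf; rewrite nth_iota ?add0n //.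
by rewrite has_find size_iota in hf.
Qed.

Lemma dist_min u v k : has_dipath u v k -> (dist u v <= k)%N.
Proof.
move=> hk; have kn := has_dipath_lt hk; rewrite leqNgt; apply/negP => lt.
by have := before_find 0%N lt; rewrite nth_iota // add0n hk.
Qed.

End Digraph.

Section DistanceMatrices.
Variables (R : rcfType) (n : nat) (e : rel 'I_n).

Definition dist_mx : 'M[R]_n := \matrix_(i, j) (dist e i j)%:R.

Definition transmission (i : 'I_n) : R := \sum_j dist_mx i j.

Definition transmission_mx : 'M[R]_n := diag_mx (\row_i transmission i).

Definition dist_laplacian : 'M[R]_n := transmission_mx - dist_mx.

Definition dist_signless_laplacian : 'M[R]_n := transmission_mx + dist_mx.

End DistanceMatrices.

Section SpectralRadius.
Variable R : rcfType.

Definition cmx n (A : 'M[R]_n) : 'M[R[i]]_n := map_mx (real_complex R) A.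

(* The complex roots of the characteristic polynomial, with multiplicities.   *)
Definition spectrum n (A : 'M[R]_n) : seq R[i] :=
  sval (closed_field_poly_normal (char_poly (cmx A))).

(* The modulus `|z| is itself in R[i] and Re recovers it as an element of R.  *)
(* The initial value 0 of the maximum is harmless since moduli are >= 0.      *)
Definition spectral_radius n (A : 'M[R]_n) : R :=
  \big[Num.max/0]_(z <- spectrum A) complex.Re `|z|.

Lemma mem_spectrum n (A : 'M[R]_n) z :
  (z \in spectrum A) = eigenvalue (cmx A) z.
Proof.
rewrite eigenvalue_root_char /spectrum.
case: closed_field_poly_normal => r /= ->.
by rewrite (monicP (char_poly_monic _)) scale1r root_prod_XsubC.
Qed.

Lemma spectral_radius_ge n (A : 'M[R]_n) z :
  eigenvalue (cmx A) z -> complex.Re `|z| <= spectral_radius A.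
Proof.
by rewrite -mem_spectrum => zA; exact: (le_bigmax_seq 0 z predT _ zA isT).
Qed.

Lemma spectral_radius_attained n (A : 'M[R]_n) : (0 < n)%N ->
  exists2 z, eigenvalue (cmx A) z & spectral_radius A = complex.Re `|z|.
Proof.
move=> n_gt0.
have : spectrum A != [::].
  apply/eqP => sA0; have := size_char_poly (cmx A).
  move: sA0; rewrite /spectrum; case: closed_field_poly_normal => r /= + r0.
  rewrite r0 big_nil (monicP (char_poly_monic _)) scale1r => ->.
  by rewrite size_poly1 => -[n0]; rewrite -n0 in n_gt0.
rewrite /spectral_radius.
suff H : forall s : seq R[i], s != [::] -> exists2 z, z \in s &
    \big[Num.max/0]_(z <- s) complex.Re `|z| = complex.Re `|z| :> R.
  by case/H => z; rewrite mem_spectrum; exists z.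
have Re_ge0 (z : R[i]) : 0 <= complex.Re `|z| by rewrite normc_def /= sqrtr_ge0.
elim=> // a [_ _|b s /(_ isT) [z zs IH] _].
  by exists a; rewrite ?mem_head // big_cons big_nil max_l.
rewrite big_cons IH; case: leP => _; last by exists a; rewrite ?mem_head.
by exists z; rewrite // inE zs orbT.
Qed.

End SpectralRadius.

(* Main.v *)
Require Import Defs.
From mathcomp Require Import all_boot all_order all_algebra.
From mathcomp Require Import complex.
From mathcomp Require Import ring.

Set Implicit Arguments.
Unset Strict Implicit.
Unset Printing Implicit Defensive.

Import Order.TTheory GRing.Theory Num.Theory.
Local Open Scope ring_scope.

(** For a real square matrix whose column i has off-diagonal entries with sum of
    squares s_i, positive when n > 1, put b_i = |a_ii| + sqrt ((n - 1) s_i). An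
    eigenvalue of modulus at least every b_i has modulus equal to every b_i; both bounds and both
    equality statements follow from this one fact, applied to an eigenvalue of
    largest modulus.

    To see it, let v be a row eigenvector for z, and put x_i = |v_i|^2 and
    T = sum_i x_i > 0. The i-th coordinate of v A = z v, the triangle
    inequality and Cauchy-Schwarz give
      (|z| - |a_ii|)^2 x_i <= s_i (T - x_i)
    ([eigenvector_coord_bound]). If |z| >= b_i, the left-hand side is at least
    (n - 1) s_i x_i, so n x_i <= T as soon as s_i > 0; for n = 1 this holds
    because x_i = T. But the numbers n x_i have average T, hence all of them
    equal T, and the displayed inequality becomes
    (|z| - |a_ii|)^2 <= (n - 1) s_i, that is |z| <= b_i
    ([balanced_weights_tight]).

    The two distance Laplacians have the transmissions on their diagonal and,
    up to sign, the distances off it, so they share the same b_i. Since distinct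
    vertices are at distance at least 1, s_i > 0 once there are two vertices. *)

Lemma sum_Cauchy_Schwarz (R : realFieldType) (I : finType) (P : pred I)
    (f g : I -> R) :
  (\sum_(i | P i) f i * g i) ^+ 2
    <= (\sum_(i | P i) f i ^+ 2) * (\sum_(i | P i) g i ^+ 2).
Proof.
rewrite -subr_ge0 -(pmulrn_lge0 _ (ltn0Sn 1)).
(* Lagrange's identity *)
suff -> : ((\sum_(i | P i) f i ^+ 2) * (\sum_(i | P i) g i ^+ 2)
            - (\sum_(i | P i) f i * g i) ^+ 2) *+ 2
          = \sum_(i | P i) \sum_(j | P j) (f i * g j - f j * g i) ^+ 2.
  by do 2!apply: sumr_ge0 => ? _; exact: sqr_ge0.
under [RHS]eq_bigr => i _.
  rewrite (eq_bigr (fun j => f i ^+ 2 * g j ^+ 2 + g i ^+ 2 * f j ^+ 2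
    - 2 * (f i * g i) * (f j * g j))); last by move=> j _; ring.
  rewrite sumrB big_split /= -!mulr_sumr.
  over.
rewrite sumrB big_split /= -!mulr_suml -mulr_sumr; ring.
Qed.

(** Let T be the sum of the x_i. From t_i^2 x_i <= s_i (T - x_i) and
    t_i^2 >= (n - 1) s_i, division by s_i (for n > 1) shows that each x_i is at
    most the average T / n; so all of them are equal to it, which turns the
    first inequality into the reverse of the second. *)
Lemma balanced_weights_tight (R : rcfType) n (x s t : 'I_n -> R) :
    0 < \sum_i x i ->
    (forall i, t i ^+ 2 * x i <= s i * (\sum_i x i - x i)) ->
    (forall i, 0 <= x i) -> (forall i, 0 <= s i) ->
    ((1 < n)%N -> forall i, 0 < s i) ->
    (forall i, Num.sqrt ((n%:R - 1) * s i) <= t i) ->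
  forall i, t i = Num.sqrt ((n%:R - 1) * s i).
Proof.
set T := \sum_i x i => T_gt0 xT x_ge0 s_ge0 s_gt0 t_ge i.
have n_gt0 : (0 < n)%N by exact: leq_ltn_trans (ltn_ord i).
have n1_ge0 : 0 <= n%:R - 1 :> R by rewrite subr_ge0 ler1n.
have t_ge0 j : 0 <= t j by exact: le_trans (sqrtr_ge0 _) (t_ge j).
have t2_ge j : (n%:R - 1) * s j <= t j ^+ 2.
  rewrite -[leLHS]sqr_sqrtr ?mulr_ge0 // ler_sqr ?nnegrE ?sqrtr_ge0 //.
have nx_le j : n%:R * x j <= T.
  have [n_gt1|n_le1] := ltnP 1 n; last first.
    have n1 : n = 1%N by apply/eqP; rewrite eqn_leq n_le1.
    rewrite n1 mul1r /T (bigD1 j) //= lerDl sumr_ge0 //.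
  suff : (n%:R - 1) * x j <= T - x j by rewrite mulrBl mul1r lerD2r.
  rewrite -(ler_pM2l (s_gt0 n_gt1 j)); apply: le_trans (xT j).
  by rewrite mulrA [s j * _]mulrC ler_wpM2r.
(* The deviations T - n x_j are nonnegative and sum to 0. *)
have nx_eq : n%:R * x i = T.
  have /eqP : \sum_j (T - n%:R * x j) = 0.
    by rewrite sumrB -mulr_sumr sumr_const card_ord -/T -[T *+ n]mulr_natl subrr.
  rewrite psumr_eq0 => [|j _]; last by rewrite subr_ge0.
  by move/allP/(_ i (mem_index_enum i)); rewrite subr_eq0 => /eqP.
have x_gt0 : 0 < x i.
  by rewrite -(pmulr_rgt0 _ (_ : 0 < n%:R :> R)) ?nx_eq // ltr0n.
apply/le_anti; rewrite t_ge andbT.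
rewrite -ler_sqr ?nnegrE ?sqrtr_ge0 // sqr_sqrtr ?mulr_ge0 //.
rewrite -(ler_pM2r x_gt0); apply: le_trans (xT i) _.
rewrite -nx_eq le_eqVlt; apply/orP; left; apply/eqP; ring.
Qed.

Lemma normcE_Re (R : rcfType) (z : R[i]) :
  `|z| = (complex.Re `|z|)%:C%C.
Proof. by rewrite normc_def. Qed.

Lemma Re_normc_ge0 (R : rcfType) (z : R[i]) : 0 <= complex.Re `|z|.
Proof. by rewrite normc_def sqrtr_ge0. Qed.

Lemma Re_normc_gt0 (R : rcfType) (z : R[i]) : (0 < complex.Re `|z|) = (z != 0).
Proof. by rewrite -normr_gt0 [in RHS]normcE_Re ltcR. Qed.

(** Eigenvectors are rows here, so coordinate i involves column i of A: this is
    why the final bound pairs the transmission of a vertex with the distances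
    towards it. *)
Lemma eigenvector_coord_bound (R : rcfType) n (A : 'M[R]_n) (z : R[i])
    (v : 'rV[R[i]]_n) (i : 'I_n) :
    let x k := complex.Re `|v 0 k| ^+ 2 in
    v *m cmx A = z *: v -> `|A i i| <= complex.Re `|z| ->
  (complex.Re `|z| - `|A i i|) ^+ 2 * x i
    <= (\sum_(k | k != i) A k i ^+ 2) * (\sum_k x k - x i).
Proof.
move=> x vA ziA.
have coord : (z - (A i i)%:C%C) * v 0 i = \sum_(k | k != i) (A k i)%:C%C * v 0 k.
  have := congr1 (fun w : 'rV_n => w 0 i) vA.
  rewrite !mxE (bigD1 i) //= !mxE mulrBl => <-.
  rewrite [_%:C%C * _]mulrC addrC addrK; apply: eq_bigr => k _.
  by rewrite !mxE mulrC.
have normR (a : R) : `|a%:C%C| = `|a|%:C%C :> R[i].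
  by rewrite normc_def /= expr0n addr0 sqrtr_sqr.
have step : (complex.Re `|z| - `|A i i|) * complex.Re `|v 0 i|
    <= \sum_(k | k != i) `|A k i| * complex.Re `|v 0 k|.
  (* The triangle inequality holds for norms in R[i], so the goal is moved there. *)
  rewrite -lecR rmorphM rmorphB rmorph_sum /= -!normcE_Re -normR.
  apply: (@le_trans _ _ `|(z - (A i i)%:C%C) * v 0 i|).
    by rewrite normrM ler_wpM2r // lerB_dist.
  rewrite coord; apply: le_trans (ler_norm_sum _ _ _) _.
  apply: ler_sum => k _.
  by rewrite normrM rmorphM /= -normcE_Re normR.
have -> : \sum_k x k - x i = \sum_(k | k != i) x k.
  by rewrite (bigD1 i) //= [LHS]addrAC subrr add0r.
rewrite -exprMn; apply: (@le_trans _ _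
  ((\sum_(k | k != i) `|A k i| * complex.Re `|v 0 k|) ^+ 2)).
  rewrite ler_sqr // nnegrE ?mulr_ge0 ?subr_ge0 ?Re_normc_ge0 //.
  by apply: sumr_ge0 => k _; rewrite mulr_ge0 ?Re_normc_ge0.
apply: le_trans (sum_Cauchy_Schwarz _ _ _) _.
by under eq_bigr => k _ do rewrite real_normK ?num_real //.
Qed.

(** Applies [balanced_weights_tight] to x_k = |v_k|^2 and t_i = |z| - |a_ii|.
    The conclusion serves twice: it refutes |z| > max b_i, and when
    |z| = max b_i it makes all the b_i equal. *)
Lemma eigenvalue_column_bound (R : rcfType) n (A : 'M[R]_n) (z : R[i]) :
    let s i := \sum_(k | k != i) A k i ^+ 2 in
    let b i := `|A i i| + Num.sqrt ((n%:R - 1) * s i) in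
    ((1 < n)%N -> forall i, 0 < s i) ->
    eigenvalue (cmx A) z -> (forall i, b i <= complex.Re `|z|) ->
  forall i, b i = complex.Re `|z|.
Proof.
move=> s b s_gt0 /eigenvalueP[v vA v_neq0] b_le i.
pose t i := complex.Re `|z| - `|A i i|.
suff /(_ i) ti : forall i, t i = Num.sqrt ((n%:R - 1) * s i).
  by rewrite /b -ti /t addrC subrK.
have sqrt_le j : Num.sqrt ((n%:R - 1) * s j) <= t j.
  by rewrite /t lerBrDl b_le.
apply: (balanced_weights_tight (x := fun k => complex.Re `|v 0 k| ^+ 2)) => //.
- have [k vk] := rV0Pn _ v_neq0.
  rewrite (bigD1 k) //=; apply: ltr_wpDr.
    by apply: sumr_ge0 => j _; exact: sqr_ge0.
  by rewrite exprn_gt0 // Re_normc_gt0.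
- move=> j; apply: eigenvector_coord_bound vA _.
  by rewrite -subr_ge0; exact: le_trans (sqrtr_ge0 _) (sqrt_le j).
- by move=> j; exact: sqr_ge0.
by move=> j; apply: sumr_ge0 => k _; exact: sqr_ge0.
Qed.

Lemma spectral_radius_column_bound (R : rcfType) n (A : 'M[R]_n) :
    let s i := \sum_(k | k != i) A k i ^+ 2 in
    let b i := `|A i i| + Num.sqrt ((n%:R - 1) * s i) in
    let M := \big[Num.max/0]_(i < n) b i in
    (0 < n)%N -> ((1 < n)%N -> forall i, 0 < s i) ->
  spectral_radius A <= M /\
  (spectral_radius A = M -> forall i j, b i = b j).
Proof.
move=> s b M n_gt0 s_gt0.
have [z zA ->] := spectral_radius_attained A n_gt0.
have b_eq := eigenvalue_column_bound s_gt0 zA.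
have b_le i : b i <= M by exact: le_bigmax.
split=> [|zM i j].
  rewrite leNgt; apply/negP => M_lt.
  have bz : b (Ordinal n_gt0) = complex.Re `|z|.
    by apply: b_eq => k; exact: le_trans (b_le k) (ltW M_lt).
  by have := b_le (Ordinal n_gt0); rewrite bz leNgt M_lt.
have bz k : b k = complex.Re `|z| by apply: b_eq => l; rewrite zM; exact: b_le.
by rewrite -/(b i) -/(b j) !bz.
Qed.

Lemma dist_gt0 n (e : rel 'I_n) u v : u != v -> (0 < dist e u v)%N.
Proof.
case: n e u v => [|n] e u v uv; first by case: u uv.
rewrite /dist /=; case: ifP => // /existsP[p].
by rewrite (tuple0 p) /= (negPf uv).
Qed.

Lemma distxx n (e : rel 'I_n) u : dist e u u = 0%N.
Proof.
apply/eqP; rewrite -leqn0; apply: dist_min.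
by apply/existsP; exists [tuple]; rewrite /= eqxx.
Qed.

Theorem theorem4p4 (R : rcfType) (n : nat) (n_gt0 : (0 < n)%N)
    (e : rel 'I_n) (e_irr : irreflexive e) (e_sc : strongly_connected e) :
  let q := spectral_radius (dist_signless_laplacian R e) in
  let mu := spectral_radius (dist_laplacian R e) in
  let b (i : 'I_n) : R := transmission R e i
    + Num.sqrt ((n%:R - 1) * \sum_(k < n) (dist_mx R e k i) ^+ 2) in
  let M : R := \big[Num.max/0]_(i < n) b i in
  [/\ q <= M, mu <= M & q = M \/ mu = M -> forall i j, b i = b j].
Proof.
move=> q mu b M.
(* The column bound depends on the off-diagonal entries through their squares,
   hence takes the same value for the two matrices. *)
have bound (A : 'M[R]_n) :
    (forall i, A i i = transmission R e i) ->
    (forall k i, k != i -> A k i ^+ 2 = dist_mx R e k i ^+ 2) ->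
  spectral_radius A <= M /\ (spectral_radius A = M -> forall i j, b i = b j).
  move=> Adiag Aoff.
  have sE i : \sum_(k | k != i) A k i ^+ 2 = \sum_k dist_mx R e k i ^+ 2.
    rewrite [RHS](bigD1 i) //= mxE distxx expr0n add0r.
    by apply: eq_bigr => k; exact: Aoff.
  have bE i : `|A i i| + Num.sqrt ((n%:R - 1) * \sum_(k | k != i) A k i ^+ 2)
      = b i.
    rewrite sE Adiag ger0_norm //.
    by apply: sumr_ge0 => j _; rewrite mxE ler0n.
  have s_gt0 : (1 < n)%N -> forall i, 0 < \sum_(k | k != i) A k i ^+ 2.
    move=> n_gt1 i.
    have [k ki] : exists k : 'I_n, k != i.
      apply/existsP; rewrite -[[exists _, _]]/(~~ pred0b (predC1 i)).
      by rewrite -lt0n cardC1 card_ord -ltnS prednK.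
    rewrite (bigD1 k) //=; apply: ltr_wpDr.
      by apply: sumr_ge0 => j _; exact: sqr_ge0.
    by rewrite Aoff // mxE exprn_gt0 // ltr0n dist_gt0.
  have [] := spectral_radius_column_bound n_gt0 s_gt0.
  under eq_bigr => i _ do rewrite bE.
  move=> leM eqM; split=> // /eqM b_eq i j.
  by have := b_eq i j; rewrite !bE.
have [||q_le q_eq] := bound (dist_signless_laplacian R e).
- by move=> i; rewrite !mxE eqxx distxx addr0.
- by move=> k i ki; rewrite !mxE (negPf ki) add0r.
have [||mu_le mu_eq] := bound (dist_laplacian R e).
- by move=> i; rewrite !mxE eqxx distxx subr0.
- by move=> k i ki; rewrite !mxE (negPf ki) sub0r sqrrN.
by split=> // -[/q_eq|/mu_eq].
Qed.
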